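(* Let $A$ be a Green $\mathcal D$-biset functor. Then the commutant $CA$ of $A$, i.e. the assignment $$G\mapsto CA(G)=\{a\in A(G)\mid \forall H\in\mathcal D,\ \forall b\in A(H),\ a\times b=A(\mathrm{Iso}_{H\times G}^{G\times H})(b\times a)\}\qquad(G\in\mathcal D),$$ is a Green $\mathcal D$-biset subfunctor of $A$.
   Context: Throughout, $R$ is a commutative unital ring, all groups are finite, and $\mathcal D$ is a non-empty class of finite groups closed under subquotients (so also under isomorphism) and cartesian products. The category $R\mathcal D$ has the groups in $\mathcal D$ as objects, $\mathrm{Hom}_{R\mathcal D}(G,H)=RB(H,G)=R\otimes_{\mathbb Z}B(H,G)$, where $B(H,G)$ is the Grothendieck group of finite $(H,G)$-bisets, and composition is induced by composition of bisets $V\circ U=V\times_G U$. A $\mathcal D$-biset functor is an $R$-linear functor $R\mathcal D\to R\text{-Mod}$. For a group isomorphism $G\to G'$, $\mathrm{Iso}_G^{G'}$ is the corresponding $(G',G)$-biset; $\mathrm{Iso}_{H\times G}^{G\times H}$ is associated with switching the components. Products $\varphi\times\psi$ of morphisms of $R\mathcal D$ are induced by cartesian products of bisets. A Green $\mathcal D$-biset functor is a $\mathcal D$-biset functor $A$ with $R$-bilinear products $A(G)\times A(H)\to A(G\times H)$, $(a,b)\mapsto a\times b$, for $G,H\in\mathcal D$, and an identity element $\varepsilon\in A(1)$, which are associative and unital up to the canonical isomorphisms $G\times(H\times K)\cong(G\times H)\times K$, $1\times G\cong G\cong G\times 1$, and satisfy $A(\varphi\times\psi)(a\times b)=A(\varphi)(a)\times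 A(\psi)(b)$ for all morphisms $\varphi,\psi$ of $R\mathcal D$. A Green $\mathcal D$-biset subfunctor is a biset subfunctor (family of $R$-submodules stable under all morphisms of $R\mathcal D$) closed under $\times$ and containing $\varepsilon$. *)

(* Defs.v *)
From HB Require Import structures.
From mathcomp Require Import all_boot ssralg ssrint fingroup morphism action.
From mathcomp Require Import quotient gproduct.
From mathcomp Require Import generic_quotient boolp.

Set Implicit Arguments.
Unset Strict Implicit.
Unset Printing Implicit Defensive.

Import GRing.Theory.
Local Open Scope ring_scope.
Local Open Scope quotient_scope.

(* The R-module presented by generators K and relations rel: the quotient of  *)
(* formal module expressions over K by the least congruence that contains rel *)
(* and the axioms of R-modules.                                               *)

Inductive mterm (R K : Type) : Type :=
| MZero
| MGen of K
| MAdd of mterm R K & mterm R K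
| MOpp of mterm R K
| MScale of R & mterm R K.
Arguments MZero {R K}.
Arguments MGen {R K}.

Inductive mcong (R : comPzRingType) (K : Type)
    (rel : mterm R K -> mterm R K -> Prop) : mterm R K -> mterm R K -> Prop :=
| mcong_rel s t : rel s t -> mcong rel s t
| mcong_refl s : mcong rel s s
| mcong_sym s t : mcong rel s t -> mcong rel t s
| mcong_trans s t u : mcong rel s t -> mcong rel t u -> mcong rel s u
| mcong_add s s' t t' :
    mcong rel s s' -> mcong rel t t' -> mcong rel (MAdd s t) (MAdd s' t')
| mcong_opp s s' : mcong rel s s' -> mcong rel (MOpp s) (MOpp s')
| mcong_scale r s s' :
    mcong rel s s' -> mcong rel (MScale r s) (MScale r s')
| mcong_addA s t u :
    mcong rel (MAdd s (MAdd t u)) (MAdd (MAdd s t) u)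
| mcong_addC s t : mcong rel (MAdd s t) (MAdd t s)
| mcong_add0 s : mcong rel (MAdd MZero s) s
| mcong_addN s : mcong rel (MAdd (MOpp s) s) MZero
| mcong_scaleA a b s :
    mcong rel (MScale a (MScale b s)) (MScale (a * b) s)
| mcong_scale1 s : mcong rel (MScale 1 s) s
| mcong_scaleDr a s t :
    mcong rel (MScale a (MAdd s t)) (MAdd (MScale a s) (MScale a t))
| mcong_scaleDl a b s :
    mcong rel (MScale (a + b) s) (MAdd (MScale a s) (MScale b s)).

HB.instance Definition _ (R K : Type) := gen_eqMixin (mterm R K).
HB.instance Definition _ (R K : Type) := gen_choiceMixin (mterm R K).

Section PresentedModule.
Variables (R : comPzRingType) (K : Type).
Variable rel : mterm R K -> mterm R K -> Prop.

Definition mcongb : ssrbool.rel (mterm R K) := fun s t => `[< mcong rel s t >].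

Lemma mcongb_equiv : equiv_class_of mcongb.
Proof.
split=> [s|s t|t s u]; first by apply/asboolP/mcong_refl.
- by apply/asboolP/asboolP => /mcong_sym.
- by move=> /asboolP st /asboolP tu; apply/asboolP; apply: mcong_trans tu.
Qed.

Canonical mcongb_rel := EquivRelPack mcongb_equiv.

Definition presmod := {eq_quot mcongb_rel}.

HB.instance Definition _ := Choice.on presmod.
HB.instance Definition _ : EqQuotient _ mcongb presmod := EqQuotient.on presmod.

Definition mpi (s : mterm R K) : presmod := \pi_presmod s.

Lemma mpiP s t : mpi s = mpi t <-> mcong rel s t.
Proof.
split=> [/eqmodP /asboolP //|st].
by apply/eqmodP/asboolP.
Qed.

Lemma repr_mpi s : mcong rel (repr (mpi s)) s.
Proof. by apply/mpiP; rewrite /mpi reprK. Qed.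

Lemma mpi_repr x : mpi (repr x) = x. Proof. exact: reprK. Qed.

Definition presmod_add (x y : presmod) := mpi (MAdd (repr x) (repr y)).
Definition presmod_opp (x : presmod) := mpi (MOpp (repr x)).
Definition presmod_scale (r : R) (x : presmod) := mpi (MScale r (repr x)).

Lemma mpi_add s t : presmod_add (mpi s) (mpi t) = mpi (MAdd s t).
Proof. by apply/mpiP/mcong_add; apply: repr_mpi. Qed.

Lemma mpi_opp s : presmod_opp (mpi s) = mpi (MOpp s).
Proof. by apply/mpiP/mcong_opp/repr_mpi. Qed.

Lemma mpi_scale r s : presmod_scale r (mpi s) = mpi (MScale r s).
Proof. by apply/mpiP/mcong_scale/repr_mpi. Qed.

Lemma presmod_addA : associative presmod_add.
Proof.
move=> x y z; rewrite -(mpi_repr x) -(mpi_repr y) -(mpi_repr z) !mpi_add.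
exact/mpiP/mcong_addA.
Qed.

Lemma presmod_addC : commutative presmod_add.
Proof.
move=> x y; rewrite -(mpi_repr x) -(mpi_repr y) !mpi_add.
exact/mpiP/mcong_addC.
Qed.

Lemma presmod_add0 : left_id (mpi MZero) presmod_add.
Proof. by move=> x; rewrite -(mpi_repr x) mpi_add; apply/mpiP/mcong_add0. Qed.

Lemma presmod_addN : left_inverse (mpi MZero) presmod_opp presmod_add.
Proof.
by move=> x; rewrite -(mpi_repr x) mpi_opp mpi_add; apply/mpiP/mcong_addN.
Qed.

HB.instance Definition _ := GRing.isZmodule.Build presmod
  presmod_addA presmod_addC presmod_add0 presmod_addN.

Lemma presmod_scaleA a b x :
  presmod_scale a (presmod_scale b x) = presmod_scale (a * b) x.
Proof.
by rewrite -(mpi_repr x) !mpi_scale; apply/mpiP/mcong_scaleA.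
Qed.

Lemma presmod_scale1 : left_id 1 presmod_scale.
Proof.
by move=> x; rewrite -(mpi_repr x) mpi_scale; apply/mpiP/mcong_scale1.
Qed.

Lemma presmod_scaleDr : right_distributive presmod_scale +%R.
Proof.
move=> a x y; rewrite -(mpi_repr x) -(mpi_repr y) /+%R /= mpi_add !mpi_scale.
by rewrite mpi_add; apply/mpiP/mcong_scaleDr.
Qed.

Lemma presmod_scaleDl x : {morph presmod_scale^~ x : a b / a + b}.
Proof.
move=> a b; rewrite -(mpi_repr x) !mpi_scale [RHS]mpi_add.
exact/mpiP/mcong_scaleDl.
Qed.

HB.instance Definition _ := GRing.Zmodule_isLmodule.Build R presmod
  presmod_scaleA presmod_scale1 presmod_scaleDr presmod_scaleDl.

Definition mgen (k : K) : presmod := mpi (MGen k).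

Lemma mpi0 : mpi MZero = 0. Proof. by []. Qed.
Lemma mpiD s t : mpi (MAdd s t) = mpi s + mpi t.
Proof. by rewrite -mpi_add. Qed.
Lemma mpiN s : mpi (MOpp s) = - mpi s. Proof. by rewrite -mpi_opp. Qed.
Lemma mpiZ r s : mpi (MScale r s) = r *: mpi s.
Proof. by rewrite -mpi_scale. Qed.

Lemma presmod_ind (P : presmod -> Prop) :
    (forall k, P (mgen k)) -> P 0 -> (forall x y, P x -> P y -> P (x + y)) ->
    (forall r x, P x -> P (r *: x)) ->
  forall x, P x.
Proof.
move=> Pgen P0 PD PZ x; rewrite -(mpi_repr x).
elim: (repr x) => [||s IHs t IHt|s IHs|r s IHs] //.
- by rewrite mpiD; apply: PD.
- by rewrite mpiN -scaleN1r; apply: PZ.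
- by rewrite mpiZ; apply: PZ.
Qed.

Fixpoint meval (V : lmodType R) (f : K -> V) (t : mterm R K) : V :=
  match t with
  | MZero => 0
  | MGen k => f k
  | MAdd s t => meval f s + meval f t
  | MOpp s => - meval f s
  | MScale r s => r *: meval f s
  end.

Lemma mpi_eval s : mpi s = meval mgen s.
Proof.
elim: s => //= [s <- t <-|s <-|r s <-].
- by rewrite mpiD.
- by rewrite mpiN.
- by rewrite mpiZ.
Qed.

(* The linear extension of f; meaningful only when f respects the relations.  *)
Definition mlift (V : lmodType R) (f : K -> V) (x : presmod) : V :=
  meval f (repr x).

Definition respects (V : lmodType R) (f : K -> V) :=
  forall s t, rel s t -> meval f s = meval f t.

Lemma respects_mgen : respects mgen.
Proof. by move=> s t st; rewrite -!mpi_eval; apply/mpiP/mcong_rel. Qed.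

Section Lift.
Variables (V : lmodType R) (f : K -> V).
Hypothesis fP : respects f.

Lemma meval_cong s t : mcong rel s t -> meval f s = meval f t.
Proof.
elim=> {s t} //=.
- by move=> s t u _ -> _ ->.
- by move=> s s' t t' _ -> _ ->.
- by move=> s s' _ ->.
- by move=> r s s' _ ->.
- by move=> s t u; rewrite addrA.
- by move=> s t; rewrite addrC.
- by move=> s; rewrite add0r.
- by move=> s; rewrite addNr.
- by move=> a b s; rewrite scalerA.
- by move=> s; rewrite scale1r.
- by move=> a s t; rewrite scalerDr.
- by move=> a b s; rewrite scalerDl.
Qed.

Lemma mlift_pi s : mlift f (mpi s) = meval f s.
Proof. exact: meval_cong (repr_mpi s). Qed.

Lemma mlift_gen k : mlift f (mgen k) = f k.
Proof. exact: mlift_pi. Qed.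

Lemma mliftD x y : mlift f (x + y) = mlift f x + mlift f y.
Proof. by rewrite -(mpi_repr x) -(mpi_repr y) -mpiD !mlift_pi. Qed.

Lemma mliftZ r x : mlift f (r *: x) = r *: mlift f x.
Proof. by rewrite -(mpi_repr x) -mpiZ !mlift_pi. Qed.

Lemma mlift0 : mlift f 0 = 0.
Proof. exact: (mlift_pi MZero). Qed.

End Lift.

End PresentedModule.

Definition mlift2 (R : comPzRingType) (K L : Type)
    (relK : mterm R K -> mterm R K -> Prop)
    (relL : mterm R L -> mterm R L -> Prop) (V : lmodType R)
    (f : K -> L -> V) (x : presmod relK) (y : presmod relL) : V :=
  mlift (fun k => mlift (f k) y) x.

Section Lift2.
Variables (R : comPzRingType) (K L : Type).
Variables (relK : mterm R K -> mterm R K -> Prop).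
Variables (relL : mterm R L -> mterm R L -> Prop).
Variables (V : lmodType R) (f : K -> L -> V).
Hypothesis fl : forall k, respects relL (f k).
Hypothesis fr : forall l, respects relK (f^~ l).

Notation lift2 := (@mlift2 R K L relK relL V f).

Lemma meval_eq (M : Type) (g h : M -> V) (s : mterm R M) :
  g =1 h -> meval g s = meval h s.
Proof.
by move=> gh; elim: s => //= [s -> t ->|s ->|r s ->].
Qed.

Lemma meval_swap s t :
  meval (fun k => meval (f k) t) s = meval (fun l => meval (f^~ l) s) t.
Proof.
elim: s => /= [|k|s IHs s' IHs'|s IHs|r s IHs].
- by elim: t => //= [s <- t <-|s <-|r s <-]; rewrite ?addr0 ?oppr0 ?scaler0.
- exact: meval_eq.
- rewrite IHs IHs'; elim: t {IHs IHs'} => //= [|t <- t' <-|t <-|r t <-].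
  + by rewrite addr0.
  + by rewrite addrACA.
  + by rewrite opprD.
  + by rewrite scalerDr.
- rewrite IHs; elim: t {IHs} => //= [|t <- t' <-|t <-|r t <-].
  + by rewrite oppr0.
  + by rewrite opprD.
  + by [].
  + by rewrite scalerN.
- rewrite IHs; elim: t {IHs} => //= [|t <- t' <-|t <-|r' t <-].
  + by rewrite scaler0.
  + by rewrite scalerDr.
  + by rewrite scalerN.
  + by rewrite !scalerA mulrC.
Qed.

Lemma mlift2E x y :
  lift2 x y = meval (fun k => mlift (f k) y) (repr x).
Proof. by []. Qed.

Lemma mlift2_respects (y : presmod relL) :
  respects relK (fun k => mlift (f k) y).
Proof.
move=> s t st; rewrite /mlift !meval_swap; apply: meval_eq => l.
exact: fr st.
Qed.

Lemma mlift2_gen k l : lift2 (mgen relK k) (mgen relL l) = f k l.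
Proof. by rewrite /mlift2 mlift_gen ?mlift_gen //; apply: mlift2_respects. Qed.

Lemma mlift2Dl x x' y : lift2 (x + x') y = lift2 x y + lift2 x' y.
Proof. exact/mliftD/mlift2_respects. Qed.

Lemma mlift2Zl r x y : lift2 (r *: x) y = r *: lift2 x y.
Proof. exact/mliftZ/mlift2_respects. Qed.

Lemma mlift2Dr x y y' : lift2 x (y + y') = lift2 x y + lift2 x y'.
Proof.
rewrite !mlift2E; elim: (repr x) => //=.
- by rewrite addr0.
- by move=> k; apply: mliftD.
- by move=> s -> t ->; rewrite addrACA.
- by move=> s ->; rewrite opprD.
- by move=> r s ->; rewrite scalerDr.
Qed.

Lemma mlift2Zr r x y : lift2 x (r *: y) = r *: lift2 x y.
Proof.
rewrite !mlift2E; elim: (repr x) => //=.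
- by rewrite scaler0.
- by move=> k; apply: mliftZ.
- by move=> s -> t ->; rewrite scalerDr.
- by move=> s ->; rewrite scalerN.
- by move=> r' s ->; rewrite !scalerA mulrC.
Qed.

End Lift2.

(* R (x)_Z M is generated by pairs (r, m), which stand for r (x) m. The       *)
(* Z-balance (r n, m) = (r, n m) follows from additivity on both sides.       *)

Inductive tensor_rel (R : comPzRingType) (M : zmodType) :
    mterm R (R * M) -> mterm R (R * M) -> Prop :=
| tensor_rel_addl r s m : tensor_rel (MGen (r + s, m))
    (MAdd (MGen (r, m)) (MGen (s, m)))
| tensor_rel_addr r m n : tensor_rel (MGen (r, m + n))
    (MAdd (MGen (r, m)) (MGen (r, n)))
| tensor_rel_scale r s m : tensor_rel (MGen (r * s, m))
    (MScale r (MGen (s, m))).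

Definition tensorZ (R : comPzRingType) (M : zmodType) :=
  presmod (@tensor_rel R M).
HB.instance Definition _ (R : comPzRingType) (M : zmodType) :=
  GRing.Lmodule.on (tensorZ R M).

Definition pure_tensor (R : comPzRingType) (M : zmodType) (r : R) (m : M) :
  tensorZ R M := mgen _ (r, m).

(* The R-bilinear extension (r (x) m, s (x) n) |-> (r s) (x) f m n of a       *)
(* biadditive f.                                                              *)
Definition tensorZ_map2 (R : comPzRingType) (M N P : zmodType)
    (f : M -> N -> P) (x : tensorZ R M) (y : tensorZ R N) : tensorZ R P :=
  mlift2 (fun u v => pure_tensor (u.1 * v.1) (f u.2 v.2)) x y.

Section PureTensor.
Variables (R : comPzRingType) (M : zmodType).

Lemma pure_tensorDl r s m :
  pure_tensor (r + s) m = pure_tensor r m + pure_tensor s m :> tensorZ R M.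
Proof. by rewrite -mpiD; apply/mpiP/mcong_rel; constructor. Qed.

Lemma pure_tensorDr r m n :
  pure_tensor r (m + n) = pure_tensor r m + pure_tensor r n :> tensorZ R M.
Proof. by rewrite -mpiD; apply/mpiP/mcong_rel; constructor. Qed.

Lemma pure_tensorZ r s m :
  pure_tensor (r * s) m = r *: pure_tensor s m :> tensorZ R M.
Proof. by rewrite -mpiZ; apply/mpiP/mcong_rel; constructor. Qed.

End PureTensor.

Section TensorMap2.
Variables (R : comPzRingType) (M N P : zmodType) (f : M -> N -> P).
Hypothesis fDl : forall y, {morph f^~ y : x x' / x + x'}.
Hypothesis fDr : forall x, {morph f x : y y' / y + y'}.

Let g (u : R * M) (v : R * N) : tensorZ R P :=
  pure_tensor (u.1 * v.1) (f u.2 v.2).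

Let gl u : respects (@tensor_rel R N) (g u).
Proof.
move=> s t []; rewrite /g /=.
- by move=> a b n; rewrite mulrDr pure_tensorDl.
- by move=> a n n'; rewrite fDr pure_tensorDr.
- by move=> a b n; rewrite mulrCA -pure_tensorZ.
Qed.

Let gr v : respects (@tensor_rel R M) (g^~ v).
Proof.
move=> s t []; rewrite /g /=.
- by move=> a b n; rewrite mulrDl pure_tensorDl.
- by move=> a n n'; rewrite fDl pure_tensorDr.
- by move=> a b n; rewrite -mulrA pure_tensorZ.
Qed.

Lemma tensorZ_map2E r s m n :
  tensorZ_map2 f (pure_tensor r m) (pure_tensor s n)
  = pure_tensor (r * s) (f m n) :> tensorZ R P.
Proof. exact: (mlift2_gen gl gr). Qed.

Lemma tensorZ_map2Dl x x' y : tensorZ_map2 f (x + x') y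
  = tensorZ_map2 f x y + tensorZ_map2 f x' y :> tensorZ R P.
Proof. exact: (mlift2Dl gr). Qed.

Lemma tensorZ_map2Dr x y y' : tensorZ_map2 f x (y + y')
  = tensorZ_map2 f x y + tensorZ_map2 f x y' :> tensorZ R P.
Proof. exact: (mlift2Dr gl). Qed.

Lemma tensorZ_map2Zl r x y :
  tensorZ_map2 f (r *: x) y = r *: tensorZ_map2 f x y :> tensorZ R P.
Proof. exact: (mlift2Zl gr). Qed.

Lemma tensorZ_map2Zr r x y :
  tensorZ_map2 f x (r *: y) = r *: tensorZ_map2 f x y :> tensorZ R P.
Proof. exact: (mlift2Zr gl). Qed.

End TensorMap2.

Record biset_on (H G : finGroupType) (T : Type) := BisetOn {
  lact_on : H -> T -> T;
  ract_on : T -> G -> T;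
  lact_on1 : forall x, lact_on 1%g x = x;
  lact_onM : forall h h' x, lact_on (h * h')%g x = lact_on h (lact_on h' x);
  ract_on1 : forall x, ract_on x 1%g = x;
  ract_onM : forall x g g', ract_on x (g * g')%g = ract_on (ract_on x g) g';
  lract_onA : forall h x g, lact_on h (ract_on x g) = ract_on (lact_on h x) g
}.

Record biset (H G : finGroupType) := Biset {
  biset_sort :> finType;
  biset_str : biset_on H G biset_sort
}.

Section BisetActions.
Variables (H G : finGroupType) (X : biset H G).

Definition lact (h : H) (x : X) : X := lact_on (biset_str X) h x.
Definition ract (x : X) (g : G) : X := ract_on (biset_str X) x g.

Lemma lact1 x : lact 1%g x = x. Proof. exact: lact_on1. Qed.
Lemma lactM h h' x : lact (h * h')%g x = lact h (lact h' x).
Proof. exact: lact_onM. Qed.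
Lemma ract1 x : ract x 1%g = x. Proof. exact: ract_on1. Qed.
Lemma ractM x g g' : ract x (g * g')%g = ract (ract x g) g'.
Proof. exact: ract_onM. Qed.
Lemma lractA h x g : lact h (ract x g) = ract (lact h x) g.
Proof. exact: lract_onA. Qed.
End BisetActions.

Definition biset_iso (H G : finGroupType) (X Y : biset H G) : Prop :=
  exists f : X -> Y, [/\ bijective f,
    forall h x, f (lact h x) = lact h (f x) &
    forall x g, f (ract x g) = ract (f x) g].

Section BisetIso.
Variables H G : finGroupType.
Implicit Types X Y Z : biset H G.

Lemma biset_iso_refl X : biset_iso X X.
Proof. by exists id; split=> //; exists id. Qed.

Lemma biset_iso_sym X Y : biset_iso X Y -> biset_iso Y X.
Proof.
case=> f [[g fK gK] fl fr]; exists g; split; first by exists f.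
- by move=> h y; rewrite -{1}(gK y) -fl fK.
- by move=> y g'; rewrite -{1}(gK y) -fr fK.
Qed.

Lemma biset_iso_trans X Y Z : biset_iso X Y -> biset_iso Y Z -> biset_iso X Z.
Proof.
case=> f [f_bij fl fr] [g [g_bij gl gr]]; exists (g \o f).
by split=> [|h x|x h] /=; [apply: bij_comp | rewrite fl gl | rewrite fr gr].
Qed.

End BisetIso.

Section BisetSum.
Variables (H G : finGroupType) (X Y : biset H G).

Definition sum_lact (h : H) (z : X + Y) : X + Y :=
  match z with inl x => inl (lact h x) | inr y => inr (lact h y) end.
Definition sum_ract (z : X + Y) (g : G) : X + Y :=
  match z with inl x => inl (ract x g) | inr y => inr (ract y g) end.

Lemma sum_lact1 z : sum_lact 1%g z = z.
Proof. by case: z => z /=; rewrite lact1. Qed.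
Lemma sum_lactM h h' z : sum_lact (h * h')%g z = sum_lact h (sum_lact h' z).
Proof. by case: z => z /=; rewrite lactM. Qed.
Lemma sum_ract1 z : sum_ract z 1%g = z.
Proof. by case: z => z /=; rewrite ract1. Qed.
Lemma sum_ractM z g g' : sum_ract z (g * g')%g = sum_ract (sum_ract z g) g'.
Proof. by case: z => z /=; rewrite ractM. Qed.
Lemma sum_lractA h z g : sum_lact h (sum_ract z g) = sum_ract (sum_lact h z) g.
Proof. by case: z => z /=; rewrite lractA. Qed.

Definition biset_sum : biset H G :=
  Biset (BisetOn sum_lact1 sum_lactM sum_ract1 sum_ractM sum_lractA).
End BisetSum.

Section BisetProd.
Variables (H G H' G' : finGroupType) (X : biset H G) (X' : biset H' G').

Definition prod_lact (h : H * H') (z : X * X') : X * X' :=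
  (lact h.1 z.1, lact h.2 z.2).
Definition prod_ract (z : X * X') (g : G * G') : X * X' :=
  (ract z.1 g.1, ract z.2 g.2).

Lemma prod_lact1 z : prod_lact 1%g z = z.
Proof. by case: z => z z'; rewrite /prod_lact /= !lact1. Qed.
Lemma prod_lactM h h' z : prod_lact (h * h')%g z = prod_lact h (prod_lact h' z).
Proof. by rewrite /prod_lact /= !lactM. Qed.
Lemma prod_ract1 z : prod_ract z 1%g = z.
Proof. by case: z => z z'; rewrite /prod_ract /= !ract1. Qed.
Lemma prod_ractM z g g' : prod_ract z (g * g')%g = prod_ract (prod_ract z g) g'.
Proof. by rewrite /prod_ract /= !ractM. Qed.
Lemma prod_lractA h z g :
  prod_lact h (prod_ract z g) = prod_ract (prod_lact h z) g.
Proof. by rewrite /prod_ract /prod_lact /= !lractA. Qed.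

Definition biset_prod : biset (H * H')%type (G * G')%type :=
  Biset (BisetOn prod_lact1 prod_lactM prod_ract1 prod_ractM prod_lractA).
End BisetProd.

Section BisetComp.
Variables (K H G : finGroupType) (V : biset K H) (U : biset H G).

Definition mid_act (x : V * U) (h : H) : V * U :=
  (ract x.1 h, lact h^-1 x.2).

Lemma mid_act1 : mid_act^~ 1%g =1 id.
Proof. by case=> v u; rewrite /mid_act /= invg1 ract1 lact1. Qed.
Lemma mid_actM x : act_morph mid_act x.
Proof. by move=> h h'; rewrite /mid_act /= invMg ractM lactM. Qed.
Definition mid_action : {action H &-> (V * U)%type} :=
  TotalAction mid_act1 mid_actM.

(* The set V x_H U of H-orbits on V x U for (v, u) . h = (v h, h^-1 u).       *)
Definition comp_sort : finType :=
  {S : {set V * U} | S \in orbit mid_action [set: H] @: [set: V * U]}.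

Definition comp_pi (x : V * U) : comp_sort :=
  exist _ (orbit mid_action [set: H] x) (imset_f _ (in_setT x)).

Lemma comp_pi_surj (S : comp_sort) : exists x, comp_pi x = S.
Proof.
by case: S => S SP; case/imsetP: (SP) => x _ Sx; exists x; apply: val_inj.
Qed.

Lemma comp_piP x y :
  reflect (exists h, y = mid_act x h) (comp_pi x == comp_pi y).
Proof.
rewrite -val_eqE /= eq_sym; apply: (iffP eqP) => [/orbit_eqP|[h ->]].
  by case/orbitP=> h _ <-; exists h.
by apply/orbit_eqP/mem_orbit; rewrite inE.
Qed.

Lemma comp_pi_mid v h u : comp_pi (ract v h, u) = comp_pi (v, lact h u).
Proof.
apply/eqP; rewrite eq_sym; apply/comp_piP; exists h.
by rewrite /mid_act /= -lactM mulVg lact1.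
Qed.

Definition comp_lact_fun (k : K) (x : V * U) := (lact k x.1, x.2).
Definition comp_ract_fun (g : G) (x : V * U) := (x.1, ract x.2 g).

Lemma imset_orbit (f : V * U -> V * U) x :
    (forall x h, f (mid_act x h) = mid_act (f x) h) ->
  f @: orbit mid_action [set: H] x = orbit mid_action [set: H] (f x).
Proof.
move=> fE; rewrite /orbit -imset_comp; apply: eq_imset => h /=; exact: fE.
Qed.

Lemma comp_lact_funE k x h :
  comp_lact_fun k (mid_act x h) = mid_act (comp_lact_fun k x) h.
Proof. by rewrite /mid_act /comp_lact_fun /= lractA. Qed.

Lemma comp_ract_funE g x h :
  comp_ract_fun g (mid_act x h) = mid_act (comp_ract_fun g x) h.
Proof. by rewrite /mid_act /comp_ract_fun /= lractA. Qed.

Lemma comp_lact_proof k (S : comp_sort) :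
  comp_lact_fun k @: val S \in orbit mid_action [set: H] @: [set: V * U].
Proof.
have [x <-] := comp_pi_surj S.
rewrite imset_orbit; last exact: comp_lact_funE.
by rewrite imset_f.
Qed.

Lemma comp_ract_proof g (S : comp_sort) :
  comp_ract_fun g @: val S \in orbit mid_action [set: H] @: [set: V * U].
Proof.
have [x <-] := comp_pi_surj S.
rewrite imset_orbit; last exact: comp_ract_funE.
by rewrite imset_f.
Qed.

Definition comp_lact (k : K) (S : comp_sort) : comp_sort :=
  exist _ (comp_lact_fun k @: val S) (comp_lact_proof k S).
Definition comp_ract (S : comp_sort) (g : G) : comp_sort :=
  exist _ (comp_ract_fun g @: val S) (comp_ract_proof g S).

Lemma comp_lact_pi k v u : comp_lact k (comp_pi (v, u)) = comp_pi (lact k v, u).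
Proof. apply: val_inj; exact: (imset_orbit _ (comp_lact_funE k)). Qed.
Lemma comp_ract_pi v u g : comp_ract (comp_pi (v, u)) g = comp_pi (v, ract u g).
Proof. apply: val_inj; exact: (imset_orbit _ (comp_ract_funE g)). Qed.

Lemma comp_lact1 S : comp_lact 1%g S = S.
Proof.
by have [[v u] <-] := comp_pi_surj S; rewrite comp_lact_pi lact1.
Qed.
Lemma comp_lactM k k' S :
  comp_lact (k * k')%g S = comp_lact k (comp_lact k' S).
Proof.
by have [[v u] <-] := comp_pi_surj S; rewrite !comp_lact_pi lactM.
Qed.
Lemma comp_ract1 S : comp_ract S 1%g = S.
Proof.
by have [[v u] <-] := comp_pi_surj S; rewrite comp_ract_pi ract1.
Qed.
Lemma comp_ractM S g g' :
  comp_ract S (g * g')%g = comp_ract (comp_ract S g) g'.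
Proof.
by have [[v u] <-] := comp_pi_surj S; rewrite !comp_ract_pi ractM.
Qed.
Lemma comp_lractA k S g :
  comp_lact k (comp_ract S g) = comp_ract (comp_lact k S) g.
Proof.
have [[v u] <-] := comp_pi_surj S.
by rewrite comp_ract_pi !comp_lact_pi comp_ract_pi.
Qed.

Definition biset_comp : biset K G :=
  Biset (BisetOn comp_lact1 comp_lactM comp_ract1 comp_ractM comp_lractA).

Lemma biset_comp_iso (W : biset K G) (p : V * U -> W) :
    (forall v h u, p (ract v h, u) = p (v, lact h u)) ->
    (forall k v u, p (lact k v, u) = lact k (p (v, u))) ->
    (forall v u g, p (v, ract u g) = ract (p (v, u)) g) ->
    (forall w, exists x, p x = w) ->
    (forall x y, p x = p y -> exists h, y = mid_act x h) ->
  biset_iso biset_comp W.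
Proof.
move=> pM pL pR p_surj p_inj.
pose f (S : biset_comp) : W := p (projT1 (cid (comp_pi_surj S))).
have fpi x : f (comp_pi x) = p x.
  rewrite /f; case: cid => y /= /eqP /comp_piP[h ->]; rewrite /mid_act pM.
  by rewrite -lactM mulgV lact1; case: (y).
exists f; split.
- pose g w := comp_pi (projT1 (cid (p_surj w))).
  exists g => [S|w]; last by rewrite /g fpi; case: cid.
  have [x <-] := comp_pi_surj S; rewrite fpi /g; case: cid => y /= /esym pyx.
  by apply/eqP; rewrite eq_sym; apply/comp_piP; apply: p_inj.
- move=> k S; have [[v u] <-] := comp_pi_surj S.
  by rewrite [lact k _]comp_lact_pi !fpi pL.
- move=> S g; have [[v u] <-] := comp_pi_surj S.
  by rewrite [ract _ g]comp_ract_pi !fpi pR.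
Qed.

End BisetComp.

Record group_iso (G G' : finGroupType) := GroupIso {
  group_iso_fun :> G -> G';
  group_isoM : {morph group_iso_fun : x y / (x * y)%g};
  group_iso_bij : bijective group_iso_fun
}.

Section IsoBiset.
Variables (G G' : finGroupType) (f : group_iso G G').

Lemma group_iso1 : f 1%g = 1%g.
Proof. by apply: (mulgI (f 1%g)); rewrite -group_isoM !mulg1. Qed.

Lemma iso_ract1 (x : G') : (x * f 1)%g = x.
Proof. by rewrite group_iso1 mulg1. Qed.
Lemma iso_ractM (x : G') g g' : (x * f (g * g'))%g = (x * f g * f g')%g.
Proof. by rewrite group_isoM mulgA. Qed.

(* G' as a left G'-set by multiplication and a right G-set through f.         *)
Definition iso_biset : biset G' G :=
  @Biset G' G G' (@BisetOn G' G G' (fun h x => h * x)%g (fun x g => x * f g)%g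
    (@mul1g G') (fun h h' x => esym (mulgA h h' x)) iso_ract1 iso_ractM
    (fun h x g => mulgA h x (f g))).
End IsoBiset.

Fact unit_mulgA : associative (fun _ _ : unit => tt). Proof. by []. Qed.
Fact unit_mul1g : left_id tt (fun _ _ : unit => tt). Proof. by case. Qed.
Fact unit_mulVg : left_inverse tt (fun _ : unit => tt) (fun _ _ => tt).
Proof. by []. Qed.
HB.instance Definition _ :=
  Finite_isGroup.Build unit unit_mulgA unit_mul1g unit_mulVg.

Section GroupIsos.
Variables G H K : finGroupType.

Lemma giso_idP : bijective (@id G). Proof. by exists id. Qed.
Definition giso_id : group_iso G G := GroupIso (fun _ _ => erefl) giso_idP.

Definition swap_fun (x : H * G) : G * H := (x.2, x.1).
Lemma swap_funM : {morph swap_fun : x y / (x * y)%g}. Proof. by []. Qed.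
Lemma swap_fun_bij : bijective swap_fun.
Proof. by exists (fun x => (x.2, x.1)); case. Qed.
Definition giso_swap : group_iso (H * G)%type (G * H)%type :=
  GroupIso swap_funM swap_fun_bij.

Definition assoc_fun (x : G * (H * K)) : (G * H) * K := (x.1, x.2.1, x.2.2).
Lemma assoc_funM : {morph assoc_fun : x y / (x * y)%g}. Proof. by []. Qed.
Lemma assoc_fun_bij : bijective assoc_fun.
Proof. by exists (fun x => (x.1.1, (x.1.2, x.2))); [case=> ? []|case=> -[]]. Qed.
Definition giso_assoc : group_iso (G * (H * K))%type ((G * H) * K)%type :=
  GroupIso assoc_funM assoc_fun_bij.

Definition unitl_fun (x : unit * G) : G := x.2.
Lemma unitl_funM : {morph unitl_fun : x y / (x * y)%g}. Proof. by []. Qed.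
Lemma unitl_fun_bij : bijective unitl_fun.
Proof.
by exists (fun x => (tt, x)) => // -[[] x].
Qed.
Definition giso_unitl : group_iso (unit * G)%type G :=
  GroupIso unitl_funM unitl_fun_bij.

Definition unitr_fun (x : G * unit) : G := x.1.
Lemma unitr_funM : {morph unitr_fun : x y / (x * y)%g}. Proof. by []. Qed.
Lemma unitr_fun_bij : bijective unitr_fun.
Proof.
by exists (fun x => (x, tt)) => // -[x []].
Qed.
Definition giso_unitr : group_iso (G * unit)%type G :=
  GroupIso unitr_funM unitr_fun_bij.

End GroupIsos.

(* Universe levels forbid taking all bisets as generators of a module, so the *)
(* Burnside group is generated by the bisets with carrier some 'I_n; every    *)
(* biset X is isomorphic to skel X of this form (skel_iso).                   *)

Record skel_biset (H G : finGroupType) := SkelBiset {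
  skel_card : nat;
  skel_str : biset_on H G 'I_skel_card
}.

Coercion biset_of_skel (H G : finGroupType) (X : skel_biset H G) : biset H G :=
  Biset (skel_str X).

Section Skeleton.
Variables (H G : finGroupType) (X : biset H G).

Definition skel_lact (h : H) (i : 'I_#|X|) : 'I_#|X| :=
  enum_rank (lact h (enum_val i)).
Definition skel_ract (i : 'I_#|X|) (g : G) : 'I_#|X| :=
  enum_rank (ract (enum_val i) g).

Lemma skel_lact1 i : skel_lact 1%g i = i.
Proof. by rewrite /skel_lact lact1 enum_valK. Qed.
Lemma skel_lactM h h' i : skel_lact (h * h')%g i = skel_lact h (skel_lact h' i).
Proof. by rewrite /skel_lact lactM enum_rankK. Qed.
Lemma skel_ract1 i : skel_ract i 1%g = i.
Proof. by rewrite /skel_ract ract1 enum_valK. Qed.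
Lemma skel_ractM i g g' : skel_ract i (g * g')%g = skel_ract (skel_ract i g) g'.
Proof. by rewrite /skel_ract ractM enum_rankK. Qed.
Lemma skel_lractA h i g :
  skel_lact h (skel_ract i g) = skel_ract (skel_lact h i) g.
Proof. by rewrite /skel_lact /skel_ract !enum_rankK lractA. Qed.

Definition skel : skel_biset H G :=
  SkelBiset (BisetOn skel_lact1 skel_lactM skel_ract1 skel_ractM skel_lractA).

Lemma skel_iso : biset_iso X skel.
Proof.
exists enum_rank; split; first exact: enum_rank_bij.
- by move=> h x; rewrite /lact /= /skel_lact enum_rankK.
- by move=> x g; rewrite /ract /= /skel_ract enum_rankK.
Qed.
End Skeleton.

Inductive burnside_rel (H G : finGroupType) :
    mterm int (skel_biset H G) -> mterm int (skel_biset H G) -> Prop :=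
| burnside_rel_iso (X Y : skel_biset H G) :
    biset_iso X Y -> burnside_rel (MGen X) (MGen Y)
| burnside_rel_sum (X Y : skel_biset H G) :
    burnside_rel (MGen (skel (biset_sum X Y))) (MAdd (MGen X) (MGen Y)).

Definition burnside (H G : finGroupType) := presmod (@burnside_rel H G).
HB.instance Definition _ (H G : finGroupType) :=
  GRing.Lmodule.on (burnside H G).

Definition bclass (H G : finGroupType) (X : biset H G) : burnside H G :=
  mgen _ (skel X).

Definition burnside_comp (K H G : finGroupType)
    (x : burnside K H) (y : burnside H G) : burnside K G :=
  mlift2 (fun (V : skel_biset K H) (U : skel_biset H G) =>
    bclass (biset_comp V U)) x y.

Definition burnside_prod (H G H' G' : finGroupType)
    (x : burnside H G) (y : burnside H' G') :
    burnside (H * H')%type (G * G')%type :=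
  mlift2 (fun (X : skel_biset H G) (Y : skel_biset H' G') =>
    bclass (biset_prod X Y)) x y.

Section BurnsideClass.
Variables H G : finGroupType.
Implicit Types X Y : biset H G.

Lemma bclass_iso X Y : biset_iso X Y -> bclass X = bclass Y.
Proof.
move=> XY; apply/mpiP/mcong_rel/burnside_rel_iso.
apply: biset_iso_trans (skel_iso Y); apply: biset_iso_trans XY.
exact/biset_iso_sym/skel_iso.
Qed.

Lemma mgen_bclass (X : skel_biset H G) : mgen (@burnside_rel H G) X = bclass X.
Proof. exact/mpiP/mcong_rel/burnside_rel_iso/skel_iso. Qed.

Lemma biset_sum_iso X X' Y Y' : biset_iso X X' -> biset_iso Y Y' ->
  biset_iso (biset_sum X Y) (biset_sum X' Y').
Proof.
case=> f [[f' fK f'K] fl fr] [g [[g' gK g'K] gl gr]].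
exists (fun z : biset_sum X Y =>
  match z with inl x => inl (f x) | inr y => inr (g y) end
  : biset_sum X' Y'); split.
- exists (fun z : biset_sum X' Y' =>
    match z with inl x => inl (f' x) | inr y => inr (g' y) end) => [] [] z;
    by rewrite ?fK ?gK ?f'K ?g'K.
- by move=> h [] z; rewrite /lact /= -?fl -?gl.
- by move=> [] z h; rewrite /ract /= -?fr -?gr.
Qed.

Lemma bclass_sum X Y : bclass (biset_sum X Y) = bclass X + bclass Y.
Proof.
transitivity (bclass (biset_sum (skel X) (skel Y))).
  by apply: bclass_iso; apply: biset_sum_iso; apply: skel_iso.
by rewrite -mpiD; apply/mpiP/mcong_rel/burnside_rel_sum.
Qed.
End BurnsideClass.

Section BisetFunctoriality.

Lemma biset_comp_congr (K H G : finGroupType) (V V' : biset K H)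
    (U U' : biset H G) :
  biset_iso V V' -> biset_iso U U' ->
  biset_iso (biset_comp V U) (biset_comp V' U').
Proof.
case=> f [[f' fK f'K] fl fr] [g [[g' gK g'K] gl gr]].
apply: (@biset_comp_iso _ _ _ V U _
  (fun x => comp_pi (f x.1, g x.2) : biset_comp V' U')) => /=.
- by move=> v h u; rewrite fr gl comp_pi_mid.
- by move=> k v u; rewrite fl [RHS]comp_lact_pi.
- by move=> v u h; rewrite gr [RHS]comp_ract_pi.
- move=> w; have [[v u] <-] := comp_pi_surj w.
  by exists (f' v, g' u); rewrite f'K g'K.
- move=> [v u] [v1 u1] /eqP/comp_piP[h [/= fv gu]]; exists h.
  rewrite /mid_act /=; congr (_, _).
  + by rewrite -(fK v1) fv -fr fK.
  + by rewrite -(gK u1) gu -gl gK.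
Qed.

Lemma biset_comp_suml (K H G : finGroupType) (V V' : biset K H)
    (U : biset H G) :
  biset_iso (biset_comp (biset_sum V V') U)
            (biset_sum (biset_comp V U) (biset_comp V' U)).
Proof.
pose W := biset_sum (biset_comp V U) (biset_comp V' U).
apply: (@biset_comp_iso _ _ _ (biset_sum V V') U W (fun x =>
  match x.1 with
  | inl v => inl (comp_pi (v, x.2)) | inr v => inr (comp_pi (v, x.2))
  end)) => /=.
- by move=> [] v h u /=; rewrite comp_pi_mid.
- by move=> k [] v u /=; rewrite [in RHS]/lact /= [X in _ = _ X]comp_lact_pi.
- by move=> [] v u h /=; rewrite [in RHS]/ract /= [X in _ = _ X]comp_ract_pi.
- move=> [] w; have [[v u] <-] := comp_pi_surj w.
  + by exists (inl v, u).
  + by exists (inr v, u).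
- move=> [[] v u] [[] v1 u1] //= [] S;
    have /eqP/comp_piP[h [-> ->]] : comp_pi (v, u) = comp_pi (v1, u1)
      by [apply: val_inj]; by exists h.
Qed.

Lemma biset_comp_sumr (K H G : finGroupType) (V : biset K H)
    (U U' : biset H G) :
  biset_iso (biset_comp V (biset_sum U U'))
            (biset_sum (biset_comp V U) (biset_comp V U')).
Proof.
pose W := biset_sum (biset_comp V U) (biset_comp V U').
apply: (@biset_comp_iso _ _ _ V (biset_sum U U') W (fun x =>
  match x.2 with
  | inl u => inl (comp_pi (x.1, u)) | inr u => inr (comp_pi (x.1, u))
  end)) => /=.
- by move=> v h [] u /=; rewrite comp_pi_mid.
- by move=> k v [] u /=; rewrite [in RHS]/lact /= [X in _ = _ X]comp_lact_pi.
- by move=> v [] u h /=; rewrite [in RHS]/ract /= [X in _ = _ X]comp_ract_pi.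
- move=> [] w; have [[v u] <-] := comp_pi_surj w.
  + by exists (v, inl u).
  + by exists (v, inr u).
- move=> [v [] u] [v1 [] u1] //= [] S;
    have /eqP/comp_piP[h [-> ->]] : comp_pi (v, u) = comp_pi (v1, u1)
      by [apply: val_inj]; by exists h.
Qed.

Lemma biset_prod_congr (H G H' G' : finGroupType) (X X1 : biset H G)
    (Y Y1 : biset H' G') :
  biset_iso X X1 -> biset_iso Y Y1 ->
  biset_iso (biset_prod X Y) (biset_prod X1 Y1).
Proof.
case=> f [[f' fK f'K] fl fr] [g [[g' gK g'K] gl gr]].
exists (fun z : biset_prod X Y => (f z.1, g z.2) : biset_prod X1 Y1); split.
- by exists (fun z : biset_prod X1 Y1 => (f' z.1, g' z.2)) => -[x y] /=;
    rewrite ?fK ?gK ?f'K ?g'K.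
- by move=> h z; rewrite /= fl gl.
- by move=> z h; rewrite /= fr gr.
Qed.

Lemma biset_prod_suml (H G H' G' : finGroupType) (X X1 : biset H G)
    (Y : biset H' G') :
  biset_iso (biset_prod (biset_sum X X1) Y)
            (biset_sum (biset_prod X Y) (biset_prod X1 Y)).
Proof.
exists (fun z => match z.1 with
  | inl x => inl (x, z.2) | inr x => inr (x, z.2) end); split.
- by exists (fun z => match z with
    | inl x => (inl x.1, x.2) | inr x => (inr x.1, x.2) end) =>
    [[[] x y]|[] []].
- by move=> h [[] x y].
- by move=> [[] x y] h.
Qed.

Lemma biset_prod_sumr (H G H' G' : finGroupType) (X : biset H G)
    (Y Y1 : biset H' G') :
  biset_iso (biset_prod X (biset_sum Y Y1))
            (biset_sum (biset_prod X Y) (biset_prod X Y1)).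
Proof.
exists (fun z => match z.2 with
  | inl y => inl (z.1, y) | inr y => inr (z.1, y) end); split.
- by exists (fun z => match z with
    | inl x => (x.1, inl x.2) | inr x => (x.1, inr x.2) end) =>
    [[x [] y]|[] []].
- by move=> h [x [] y].
- by move=> [x [] y] h.
Qed.

End BisetFunctoriality.

Section BisetCategory.

Section Assoc.
Variables (L K H G : finGroupType).
Variables (V : biset L K) (U : biset K H) (T : biset H G).
Let W := biset_comp V (biset_comp U T).

Let q (v : V) (u : U) (t : T) : W :=
  comp_pi (v, comp_pi (u, t) : biset_comp U T).

Let rep (S : biset_comp V U) : V * U := projT1 (cid (comp_pi_surj S)).

Let p (x : biset_comp V U * T) : W := q (rep x.1).1 (rep x.1).2 x.2.

Let qM v k u t : q (ract v k) u t = q v (lact k u) t.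
Proof. by rewrite /q comp_pi_mid [lact k _]comp_lact_pi. Qed.

Let pE v u t : p (comp_pi (v, u), t) = q v u t.
Proof.
rewrite /p /rep /=; case: cid => -[v1 u1] /= /eqP/comp_piP[k [-> ->]].
by rewrite /= qM -lactM mulgV lact1.
Qed.

Lemma biset_comp_assoc :
  biset_iso (biset_comp (biset_comp V U) T) (biset_comp V (biset_comp U T)).
Proof.
apply: (@biset_comp_iso _ _ _ (biset_comp V U) T W p).
- move=> S h t; have [[v u] <-] := comp_pi_surj S.
  by rewrite [ract _ h]comp_ract_pi !pE /q comp_pi_mid.
- move=> k S t; have [[v u] <-] := comp_pi_surj S.
  by rewrite [lact k _]comp_lact_pi !pE [RHS]comp_lact_pi.
- move=> S t g; have [[v u] <-] := comp_pi_surj S.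
  rewrite !pE [RHS]comp_ract_pi /q; congr (comp_pi (_, _)).
  exact/esym/comp_ract_pi.
- move=> w; have [[v S] <-] := comp_pi_surj w.
  have [[u t] <-] := comp_pi_surj S.
  by exists (comp_pi (v, u), t); rewrite pE.
- move=> [S t] [S1 t1]; have [[v u] <-] := comp_pi_surj S.
  have [[v1 u1] <-] := comp_pi_surj S1; rewrite !pE.
  move=> /eqP/comp_piP[k e0].
  have /= -> := congr1 fst e0; have /= e := congr1 snd e0.
  have /esym/eqP/comp_piP[h [-> ->]] :
      comp_pi (u1, t1) = comp_pi (lact k^-1 u, t).
    by rewrite e; apply: comp_lact_pi.
  exists h; rewrite /mid_act /=; congr (_, _).
  by rewrite [RHS]comp_ract_pi comp_pi_mid lractA -lactM mulgV lact1.
Qed.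
End Assoc.

Lemma biset_comp_idl (H G : finGroupType) (X : biset H G) :
  biset_iso (biset_comp (iso_biset (giso_id H)) X) X.
Proof.
apply: (@biset_comp_iso _ _ _ (iso_biset (giso_id H)) X X
  (fun x => lact (x.1 : H) x.2)) => /=.
- by move=> v h u; apply: lactM.
- by move=> k v u; apply: lactM.
- by move=> v u g; apply: lractA.
- by move=> w; exists (1%g : H, w); rewrite lact1.
- move=> [v u] [v1 u1] /= e; exists (v^-1 * v1)%g.
  rewrite /mid_act /= /ract /= mulKVg invMg invgK lactM e -lactM.
  by rewrite mulVg lact1.
Qed.

Lemma biset_comp_idr (H G : finGroupType) (X : biset H G) :
  biset_iso (biset_comp X (iso_biset (giso_id G))) X.
Proof.
apply: (@biset_comp_iso _ _ _ X (iso_biset (giso_id G)) X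
  (fun x => ract x.1 (x.2 : G))) => /=.
- by move=> v h u; apply/esym/ractM.
- by move=> k v u; apply/esym/lractA.
- by move=> v u g; apply: ractM.
- by move=> w; exists (w, 1%g : G); rewrite ract1.
- move=> [v u] [v1 u1] /= e; exists (u * u1^-1)%g.
  rewrite /mid_act /= /lact /= ractM e -ractM mulgV ract1.
  by rewrite invMg invgK mulgKV.
Qed.

End BisetCategory.

Section BurnsideBilinear.

Lemma burnside_respects (H G : finGroupType) (V : lmodType int)
    (F : biset H G -> V) :
    (forall X Y, biset_iso X Y -> F X = F Y) ->
    (forall X Y, F (biset_sum X Y) = F X + F Y) ->
  respects (@burnside_rel H G) (fun X : skel_biset H G => F X).
Proof.
move=> Fiso Fsum s t [X Y /Fiso //|X Y /=]; rewrite -Fsum.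
exact/esym/Fiso/skel_iso.
Qed.

Section Comp.
Variables K H G : finGroupType.

Let respl (V : skel_biset K H) : respects (@burnside_rel H G)
  (fun U : skel_biset H G => bclass (biset_comp V U)).
Proof.
apply: (burnside_respects (F := fun U => bclass (biset_comp V U))) => U U'.
  by move=> UU'; apply/bclass_iso/biset_comp_congr => //; apply: biset_iso_refl.
by rewrite -bclass_sum; apply/bclass_iso/biset_comp_sumr.
Qed.

Let respr (U : skel_biset H G) : respects (@burnside_rel K H)
  (fun V : skel_biset K H => bclass (biset_comp V U)).
Proof.
apply: (burnside_respects (F := fun V => bclass (biset_comp V U))) => V V'.
  by move=> VV'; apply/bclass_iso/biset_comp_congr => //; apply: biset_iso_refl.
by rewrite -bclass_sum; apply/bclass_iso/biset_comp_suml.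
Qed.

Lemma burnside_compE (V : biset K H) (U : biset H G) :
  burnside_comp (bclass V) (bclass U) = bclass (biset_comp V U).
Proof.
rewrite /burnside_comp (mlift2_gen respl respr).
by apply/bclass_iso/biset_comp_congr; apply/biset_iso_sym/skel_iso.
Qed.

Lemma burnside_compDl (x x' : burnside K H) (y : burnside H G) :
  burnside_comp (x + x') y = burnside_comp x y + burnside_comp x' y.
Proof. exact: (mlift2Dl respr). Qed.

Lemma burnside_compDr (x : burnside K H) (y y' : burnside H G) :
  burnside_comp x (y + y') = burnside_comp x y + burnside_comp x y'.
Proof. exact: (mlift2Dr respl). Qed.
End Comp.

Section Prod.
Variables H G H' G' : finGroupType.

Let respl (X : skel_biset H G) : respects (@burnside_rel H' G')
  (fun Y : skel_biset H' G' => bclass (biset_prod X Y)).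
Proof.
apply: (burnside_respects (F := fun Y => bclass (biset_prod X Y))) => Y Y'.
  by move=> YY'; apply/bclass_iso/biset_prod_congr => //; apply: biset_iso_refl.
by rewrite -bclass_sum; apply/bclass_iso/biset_prod_sumr.
Qed.

Let respr (Y : skel_biset H' G') : respects (@burnside_rel H G)
  (fun X : skel_biset H G => bclass (biset_prod X Y)).
Proof.
apply: (burnside_respects (F := fun X => bclass (biset_prod X Y))) => X X'.
  by move=> XX'; apply/bclass_iso/biset_prod_congr => //; apply: biset_iso_refl.
by rewrite -bclass_sum; apply/bclass_iso/biset_prod_suml.
Qed.

Lemma burnside_prodE (X : biset H G) (Y : biset H' G') :
  burnside_prod (bclass X) (bclass Y) = bclass (biset_prod X Y).
Proof.
rewrite /burnside_prod (mlift2_gen respl respr).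
by apply/bclass_iso/biset_prod_congr; apply/biset_iso_sym/skel_iso.
Qed.

Lemma burnside_prodDl (x x' : burnside H G) (y : burnside H' G') :
  burnside_prod (x + x') y = burnside_prod x y + burnside_prod x' y.
Proof. exact: (mlift2Dl respr). Qed.

Lemma burnside_prodDr (x : burnside H G) (y y' : burnside H' G') :
  burnside_prod x (y + y') = burnside_prod x y + burnside_prod x y'.
Proof. exact: (mlift2Dr respl). Qed.
End Prod.

End BurnsideBilinear.

(* Morphisms G -> H are the elements of RB R H G = R (x)_Z B(H, G): the       *)
(* target comes first, as for bisets.                                         *)

Definition RB (R : comPzRingType) (H G : finGroupType) :=
  tensorZ R (burnside H G).
HB.instance Definition _ (R : comPzRingType) (H G : finGroupType) :=
  GRing.Lmodule.on (RB R H G).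

Definition RBclass (R : comPzRingType) (H G : finGroupType) (X : biset H G) :
  RB R H G := pure_tensor 1 (bclass X).

Definition RBcomp (R : comPzRingType) (K H G : finGroupType)
    (phi : RB R K H) (psi : RB R H G) : RB R K G :=
  tensorZ_map2 (@burnside_comp K H G) phi psi.

Definition RBprod (R : comPzRingType) (H G H' G' : finGroupType)
    (phi : RB R H G) (psi : RB R H' G') :
    RB R (H * H')%type (G * G')%type :=
  tensorZ_map2 (@burnside_prod H G H' G') phi psi.

Definition RBiso (R : comPzRingType) (G G' : finGroupType)
    (f : group_iso G G') : RB R G' G := RBclass R (iso_biset f).

Definition RBid (R : comPzRingType) (G : finGroupType) : RB R G G :=
  RBiso R (giso_id G).

Lemma RBcompE (R : comPzRingType) (K H G : finGroupType)
    (V : biset K H) (U : biset H G) :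
  RBcomp (RBclass R V) (RBclass R U) = RBclass R (biset_comp V U).
Proof.
rewrite /RBcomp tensorZ_map2E ?burnside_compE ?mulr1 //.
- by move=> y x x'; apply: burnside_compDl.
- by move=> x y y'; apply: burnside_compDr.
Qed.

Lemma RBprodE (R : comPzRingType) (H G H' G' : finGroupType)
    (X : biset H G) (Y : biset H' G') :
  RBprod (RBclass R X) (RBclass R Y) = RBclass R (biset_prod X Y).
Proof.
rewrite /RBprod tensorZ_map2E ?burnside_prodE ?mulr1 //.
- by move=> y x x'; apply: burnside_prodDl.
- by move=> x y y'; apply: burnside_prodDr.
Qed.

Section RBBilinear.
Variable R : comPzRingType.

Lemma RBcomp_linearl (K H G : finGroupType) (psi : RB R H G) :
  linear (fun phi : RB R K H => RBcomp phi psi).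
Proof.
have fDl y : {morph (@burnside_comp K H G)^~ y : x x' / x + x'}.
  by move=> x x'; apply: burnside_compDl.
by move=> r x x'; rewrite /RBcomp (tensorZ_map2Dl fDl) (tensorZ_map2Zl fDl).
Qed.

Lemma RBcomp_linearr (K H G : finGroupType) (phi : RB R K H) :
  linear (fun psi : RB R H G => RBcomp phi psi).
Proof.
have fDr x : {morph (@burnside_comp K H G) x : y y' / y + y'}.
  by move=> y y'; apply: burnside_compDr.
by move=> r x x'; rewrite /RBcomp (tensorZ_map2Dr fDr) (tensorZ_map2Zr fDr).
Qed.

Lemma RBprod_linearl (H G H' G' : finGroupType) (psi : RB R H' G') :
  linear (fun phi : RB R H G => RBprod phi psi).
Proof.
have fDl y : {morph (@burnside_prod H G H' G')^~ y : x x' / x + x'}.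
  by move=> x x'; apply: burnside_prodDl.
by move=> r x x'; rewrite /RBprod (tensorZ_map2Dl fDl) (tensorZ_map2Zl fDl).
Qed.

Lemma RBprod_linearr (H G H' G' : finGroupType) (phi : RB R H G) :
  linear (fun psi : RB R H' G' => RBprod phi psi).
Proof.
have fDr x : {morph (@burnside_prod H G H' G') x : y y' / y + y'}.
  by move=> y y'; apply: burnside_prodDr.
by move=> r x x'; rewrite /RBprod (tensorZ_map2Dr fDr) (tensorZ_map2Zr fDr).
Qed.

Lemma RB_ind (H G : finGroupType) (P : RB R H G -> Prop) :
    (forall X, P (RBclass R X)) -> P 0 ->
    (forall x y, P x -> P y -> P (x + y)) ->
    (forall r x, P x -> P (r *: x)) ->
  forall x, P x.
Proof.
move=> PX P0 PD PZ; apply: presmod_ind => // -[r m].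
rewrite -[mgen _ _]/(pure_tensor r m) -[r]mulr1 pure_tensorZ; apply: (PZ).
have t0 : pure_tensor 1 0 = 0 :> RB R H G.
  by apply: (addrI (pure_tensor 1 0)); rewrite -pure_tensorDr !addr0.
have tN (n : burnside H G) :
    pure_tensor 1 (- n) = - pure_tensor 1 n :> RB R H G.
  by apply: (addrI (pure_tensor 1 n)); rewrite -pure_tensorDr !subrr t0.
have PN x : P x -> P (- x) by rewrite -scaleN1r; apply: PZ.
elim/presmod_ind: m => [X||x y Px Py|z x Px].
- by rewrite mgen_bclass; apply: PX.
- by rewrite t0.
- by rewrite pure_tensorDr; apply: PD.
rewrite -[z]intz scaler_int; elim/int_ind: z => [|n IHn|n IHn].
- by rewrite mulr0z t0.
- by rewrite intS mulrzDr mulr1z pure_tensorDr; apply: PD.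
- by rewrite intS opprD mulrzDr mulrN1z pure_tensorDr tN; apply: PD => //;
    apply: PN.
Qed.

Lemma RB_linear_ext (H G : finGroupType) (M : lmodType R) (f g : RB R H G -> M) :
    linear f -> linear g ->
    (forall X, f (RBclass R X) = g (RBclass R X)) ->
  f =1 g.
Proof.
have l0 (h : RB R H G -> M) : linear h -> h 0 = 0.
  move=> hl; have := hl (-1) 0 0.
  by rewrite scaler0 addr0 /= scaleN1r addNr.
move=> fl gl fg; apply: RB_ind => [//||x y fx fy|r x fx].
- by rewrite (l0 f) ?(l0 g).
- by rewrite -[x]scale1r fl gl fx fy.
- by rewrite -[r *: x]addr0 fl gl fx (l0 f) ?(l0 g).
Qed.

Lemma RBcompA (L K H G : finGroupType) (phi : RB R L K) (psi : RB R K H)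
    (chi : RB R H G) :
  RBcomp phi (RBcomp psi chi) = RBcomp (RBcomp phi psi) chi.
Proof.
move: phi; apply: RB_linear_ext => [r x y|r x y|V].
- by rewrite RBcomp_linearl.
- by rewrite !RBcomp_linearl.
move: psi; apply: RB_linear_ext => [r x y|r x y|U].
- by rewrite RBcomp_linearl RBcomp_linearr.
- by rewrite RBcomp_linearr RBcomp_linearl.
move: chi; apply: RB_linear_ext => [r x y|r x y|T].
- by rewrite !RBcomp_linearr.
- by rewrite RBcomp_linearr.
by rewrite !RBcompE; congr pure_tensor; apply/esym/bclass_iso/biset_comp_assoc.
Qed.

Lemma RBcomp_idl (H G : finGroupType) (phi : RB R H G) :
  RBcomp (RBid R H) phi = phi.
Proof.
move: phi; apply: RB_linear_ext => [||X] //; first exact: RBcomp_linearr.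
by rewrite RBcompE; congr pure_tensor; apply/bclass_iso/biset_comp_idl.
Qed.

Lemma RBcomp_idr (H G : finGroupType) (phi : RB R H G) :
  RBcomp phi (RBid R G) = phi.
Proof.
move: phi; apply: RB_linear_ext => [||X] //; first exact: RBcomp_linearl.
by rewrite RBcompE; congr pure_tensor; apply/bclass_iso/biset_comp_idr.
Qed.

End RBBilinear.

(* Any group isomorphic to a subquotient of a member is a member: in          *)
(* particular (take K = 1 and H = G) the class is closed under isomorphism.   *)
Record group_class := GroupClass {
  gc_mem :> finGroupType -> Prop;
  gc_nonempty : exists G, gc_mem G;
  gc_subquotient : forall (G Q : finGroupType) (H K : {group G}),
    gc_mem G -> (K <| H)%g -> ([set: Q] \isog H / K)%g -> gc_mem Q;
  gc_prod : forall G H, gc_mem G -> gc_mem H -> gc_mem (G * H)%type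
}.

Lemma gc_unit (D : group_class) : D unit.
Proof.
have [G DG] := gc_nonempty D.
apply: (gc_subquotient (H := 1%G) (K := 1%G) DG (normal_refl _)).
apply: trivial_isog; last exact: trivg_quotient.
by apply/setP=> -[]; rewrite !inE.
Qed.

Record gc_obj (D : group_class) := GcObj {
  gc_group :> finGroupType;
  gc_groupP : D gc_group
}.

Definition obj_prod (D : group_class) (G H : gc_obj D) : gc_obj D :=
  GcObj (gc_prod (gc_groupP G) (gc_groupP H)).
Definition obj_unit (D : group_class) : gc_obj D := GcObj (gc_unit D).

Record biset_functor (R : comPzRingType) (D : group_class) := BisetFunctor {
  bf_obj :> gc_obj D -> lmodType R;
  bf_map : forall G H : gc_obj D, RB R H G -> {linear bf_obj G -> bf_obj H};
  bf_map_linear : forall (G H : gc_obj D) (r : R) (phi psi : RB R H G)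
      (a : bf_obj G),
    bf_map (r *: phi + psi) a = r *: bf_map phi a + bf_map psi a;
  bf_map_id : forall (G : gc_obj D) (a : bf_obj G), bf_map (RBid R G) a = a;
  bf_map_comp : forall (G H K : gc_obj D) (phi : RB R K H) (psi : RB R H G)
      (a : bf_obj G),
    bf_map (RBcomp phi psi) a = bf_map phi (bf_map psi a)
}.

Record green_functor (R : comPzRingType) (D : group_class) := GreenFunctor {
  gf_functor :> biset_functor R D;
  gmul : forall G H : gc_obj D,
    gf_functor G -> gf_functor H -> gf_functor (obj_prod G H);
  gone : gf_functor (obj_unit D);
  gmul_linearl : forall (G H : gc_obj D) (b : gf_functor H),
    linear (fun a : gf_functor G => gmul a b);
  gmul_linearr : forall (G H : gc_obj D) (a : gf_functor G),
    linear (fun b : gf_functor H => gmul a b);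
  gmulA : forall (G H K : gc_obj D)
      (a : gf_functor G) (b : gf_functor H) (c : gf_functor K),
    bf_map gf_functor
      (G := obj_prod G (obj_prod H K)) (H := obj_prod (obj_prod G H) K)
      (RBiso R (giso_assoc G H K)) (gmul a (gmul b c))
    = gmul (gmul a b) c;
  gmul1l : forall (G : gc_obj D) (a : gf_functor G),
    bf_map gf_functor (G := obj_prod (obj_unit D) G) (H := G)
      (RBiso R (giso_unitl G)) (gmul gone a) = a;
  gmul1r : forall (G : gc_obj D) (a : gf_functor G),
    bf_map gf_functor (G := obj_prod G (obj_unit D)) (H := G)
      (RBiso R (giso_unitr G)) (gmul a gone) = a;
  gmul_map : forall (G G' H H' : gc_obj D)
      (phi : RB R G' G) (psi : RB R H' H)
      (a : gf_functor G) (b : gf_functor H),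
    bf_map gf_functor (G := obj_prod G H) (H := obj_prod G' H')
      (RBprod phi psi) (gmul a b)
    = gmul (bf_map gf_functor phi a) (bf_map gf_functor psi b)
}.

Definition biset_subfunctor (R : comPzRingType) (D : group_class)
    (A : biset_functor R D) (S : forall G : gc_obj D, {pred A G}) : Prop :=
  (forall G, GRing.submod_closed (S G)) /\
  (forall (G H : gc_obj D) (phi : RB R H G) (a : A G),
    a \in S G -> bf_map A phi a \in S H).

Definition green_subfunctor (R : comPzRingType) (D : group_class)
    (A : green_functor R D) (S : forall G : gc_obj D, {pred A G}) : Prop :=
  [/\ biset_subfunctor S,
      forall (G H : gc_obj D) (a : A G) (b : A H),
        a \in S G -> b \in S H -> gmul a b \in S (obj_prod G H) &
      gone A \in S (obj_unit D)].

Definition commutant (R : comPzRingType) (D : group_class)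
    (A : green_functor R D) (G : gc_obj D) : {pred A G} :=
  [pred a | `[< forall (H : gc_obj D) (b : A H),
     gmul a b = bf_map A (G := obj_prod H G) (H := obj_prod G H)
                  (RBiso R (giso_swap G H)) (gmul b a) >]].

Arguments commutant {R D} A G _.

(* Main.v *)
(* Switching factors is natural: Iso o (psi x phi) = (phi x psi) o Iso in RD,
   which gives stability under morphisms.  Isomorphism bisets compose like group
   isomorphisms, so for a, b in CA the elements (a x b) x c, a x (c x b),
   (c x a) x b and c x (a x b) are images of one another under permutations of
   the factors, and the total permutation is the switch.  The identity element
   commutes with every b because the unit isomorphisms carry both products
   to b. *)
Require Import Defs.
From mathcomp Require Import all_boot ssralg.
From mathcomp Require Import fingroup gproduct boolp.

Set Implicit Arguments.
Unset Strict Implicit.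
Unset Printing Implicit Defensive.

Import GRing.Theory.
Local Open Scope ring_scope.

(** * Composites, products and inverses of group isomorphisms *)

Section GroupIsoOperations.
Variables G H K G' H' : finGroupType.

Section Comp.
Variables (f : group_iso H K) (g : group_iso G H).

Lemma giso_comp_morph : {morph f \o g : x y / (x * y)%g}.
Proof. by move=> x y /=; rewrite !group_isoM. Qed.

Definition giso_comp : group_iso G K :=
  GroupIso giso_comp_morph (bij_comp (group_iso_bij f) (group_iso_bij g)).
End Comp.

Section Prod.
Variables (f : group_iso G G') (g : group_iso H H').

Definition prod_fun (x : G * H) : G' * H' := (f x.1, g x.2).

Lemma prod_fun_morph : {morph prod_fun : x y / (x * y)%g}.
Proof. by move=> x y; rewrite /prod_fun /= !group_isoM. Qed.

Lemma prod_fun_bij : bijective prod_fun.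
Proof.
have [[f' fK f'K] [g' gK g'K]] := (group_iso_bij f, group_iso_bij g).
by exists (fun x => (f' x.1, g' x.2)) => -[x y];
  rewrite /prod_fun /= ?fK ?gK ?f'K ?g'K.
Qed.

Definition giso_prod : group_iso (G * H)%type (G' * H')%type :=
  GroupIso prod_fun_morph prod_fun_bij.
End Prod.

Section Inv.
Variable f : group_iso G G'.
Let f_inj : injective f := bij_inj (group_iso_bij f).
Let card_le : (#|G'| <= #|G|)%N :=
  eq_leq (esym (bij_eq_card (group_iso_bij f))).

(** Bijectivity is only a proposition here, so the inverse is a chosen preimage: an injection
    between finite sets of equal size is onto. *)
Definition giso_inv_fun (y : G') : G := iinv (inj_card_onto f_inj card_le y).

Lemma giso_inv_funK : cancel giso_inv_fun f.
Proof. by move=> y; apply: f_iinv. Qed.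

Lemma giso_funK : cancel f giso_inv_fun.
Proof. by move=> x; apply: f_inj; apply: giso_inv_funK. Qed.

Lemma giso_inv_morph : {morph giso_inv_fun : x y / (x * y)%g}.
Proof. by move=> x y; apply: f_inj; rewrite group_isoM !giso_inv_funK. Qed.

Definition giso_inv : group_iso G' G :=
  GroupIso giso_inv_morph (Bijective giso_inv_funK giso_funK).
End Inv.

End GroupIsoOperations.

(** * Composition and products of isomorphism bisets *)

Section BisetIsos.

(** Each class in [biset_comp Y (iso_biset f)] has a representative [(y, 1)], and [(v, x)]
    corresponds to [y = v . t x]. This turns a bijection equivariant along [k] and [f] into a
    commuting square of bisets. *)
Lemma biset_comp_intertwine (G H G' H' : finGroupType) (f : group_iso G G')
    (k : group_iso H H') (X : biset H G) (Y : biset H' G') (t : X -> Y) :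
    bijective t ->
    (forall h x, t (lact h x) = lact (k h) (t x)) ->
    (forall x g, t (ract x g) = ract (t x) (f g)) ->
  biset_iso (biset_comp (iso_biset k) X) (biset_comp Y (iso_biset f)).
Proof.
move=> [t' tK t'K] tl tr.
apply: (@biset_comp_iso _ _ _ (iso_biset k) X _
  (fun z => comp_pi (lact (z.1 : H') (t z.2), 1%g : iso_biset f)
            : biset_comp Y (iso_biset f))).
- by move=> v h x /=; rewrite tl -lactM.
- by move=> h v x /=; rewrite [RHS]comp_lact_pi -lactM.
- move=> v x g /=; rewrite tr lractA comp_pi_mid [RHS]comp_ract_pi.
  by rewrite /lact /ract /= mulg1 mul1g.
- move=> w; have [[y u] <-] := comp_pi_surj w.
  (* The class of [(y, u)] is that of [(y u, 1)]. *)
  exists (1%g : H', t' (ract y (u : G'))); rewrite /= lact1 t'K comp_pi_mid.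
  by rewrite /lact /= mulg1.
- move=> [v x] [v1 x1] /eqP/comp_piP[g' [/= e]].
  (* Both second coordinates are 1, so [g'] is trivial and [v . t x = v1 . t x1]. The middle element
     [h] is then forced by [v1 = v * k h]. *)
  rewrite /lact /= mulg1 -[X in X = _]invg1 => /invg_inj g'1.
  move: e; rewrite -g'1 ract1 => e.
  exists (giso_inv k (v^-1 * v1)%g); rewrite /mid_act /=; congr (_, _).
    by rewrite /ract /= giso_inv_funK mulKVg.
  apply: (can_inj tK).
  have kV y : k (y^-1)%g = (k y)^-1%g.
    by apply: (mulIg (k y)); rewrite -group_isoM !mulVg group_iso1.
  rewrite tl kV giso_inv_funK invMg invgK lactM -e -lactM.
  by rewrite mulVg lact1.
Qed.

(** The coordinate flip is equivariant along the two group switches, so it intertwines them. *)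
Lemma biset_comp_swap (G G' H H' : finGroupType)
    (X : biset G' G) (Y : biset H' H) :
  biset_iso (biset_comp (iso_biset (giso_swap G' H')) (biset_prod Y X))
            (biset_comp (biset_prod X Y) (iso_biset (giso_swap G H))).
Proof.
apply: (biset_comp_intertwine
  (t := fun z : biset_prod Y X => (z.2, z.1) : biset_prod X Y)) => //.
by exists (fun z => (z.2, z.1)) => -[].
Qed.

Lemma iso_biset_ext (G H : finGroupType) (f g : group_iso G H) :
  f =1 g -> biset_iso (iso_biset f) (iso_biset g).
Proof.
move=> fg; exists id; split=> //; first by exists id.
by move=> x h; rewrite /ract /= fg.
Qed.

Lemma iso_biset_comp (G H K : finGroupType) (f : group_iso H K)
    (g : group_iso G H) :
  biset_iso (biset_comp (iso_biset f) (iso_biset g))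
            (iso_biset (giso_comp f g)).
Proof.
apply: (@biset_comp_iso _ _ _ (iso_biset f) (iso_biset g)
  (iso_biset (giso_comp f g)) (fun z => (z.1 : K) * f (z.2 : H))%g) => /=.
- by move=> v h u; rewrite /ract /lact /= group_isoM mulgA.
- by move=> k v u; rewrite /lact /= mulgA.
- by move=> v u x; rewrite /ract /= group_isoM mulgA.
- by move=> w; exists (w, 1%g : H); rewrite /= group_iso1 mulg1.
(* The middle element [h] must satisfy [u1 = h^-1 * u]. *)
- move=> [v u] [v1 u1] /= e; exists (u * u1^-1)%g.
  rewrite /mid_act /ract /lact /= invMg invgK mulgKV group_isoM mulgA e.
  by rewrite -mulgA -group_isoM mulgV group_iso1 mulg1.
Qed.

Lemma iso_biset_prod (G G' H H' : finGroupType) (f : group_iso G G')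
    (g : group_iso H H') :
  biset_iso (biset_prod (iso_biset f) (iso_biset g))
            (iso_biset (giso_prod f g)).
Proof. by exists id; split=> //; exists id. Qed.

End BisetIsos.

(** * Isomorphisms and switches as morphisms over [R] *)

Section RBIsos.
Variable R : comPzRingType.

Lemma RBclass_iso (G H : finGroupType) (X Y : biset H G) :
  biset_iso X Y -> RBclass R X = RBclass R Y.
Proof. by move=> XY; congr pure_tensor; apply: bclass_iso. Qed.

Lemma RBiso_ext (G H : finGroupType) (f g : group_iso G H) :
  f =1 g -> RBiso R f = RBiso R g.
Proof. by move=> fg; apply/RBclass_iso/iso_biset_ext. Qed.

Lemma RBiso_comp (G H K : finGroupType) (f : group_iso H K)
    (g : group_iso G H) :
  RBcomp (RBiso R f) (RBiso R g) = RBiso R (giso_comp f g).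
Proof. by rewrite RBcompE; apply/RBclass_iso/iso_biset_comp. Qed.

Lemma RBiso_prod (G G' H H' : finGroupType) (f : group_iso G G')
    (g : group_iso H H') :
  RBprod (RBiso R f) (RBiso R g) = RBiso R (giso_prod f g).
Proof. by rewrite RBprodE; apply/RBclass_iso/iso_biset_prod. Qed.

(** Both sides are linear in [phi] and in [psi], so it suffices to compare them on classes of
    bisets. *)
Lemma RBiso_swapC (G G' H H' : finGroupType)
    (phi : RB R G' G) (psi : RB R H' H) :
  RBcomp (RBiso R (giso_swap G' H')) (RBprod psi phi)
  = RBcomp (RBprod phi psi) (RBiso R (giso_swap G H)).
Proof.
move: phi; apply: RB_linear_ext => [r x y|r x y|X].
- by rewrite RBprod_linearr RBcomp_linearr.
- by rewrite RBprod_linearl RBcomp_linearl.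
move: psi; apply: RB_linear_ext => [r x y|r x y|Y].
- by rewrite RBprod_linearl RBcomp_linearr.
- by rewrite RBprod_linearr RBcomp_linearl.
by rewrite !RBprodE !RBcompE; apply/RBclass_iso/biset_comp_swap.
Qed.

End RBIsos.

(** * The action of group isomorphisms on a biset functor *)

Section BisetFunctorIso.
Variables (R : comPzRingType) (D : group_class) (A : biset_functor R D).

Definition bf_iso (G H : gc_obj D) (f : group_iso G H) (a : A G) : A H :=
  bf_map A (RBiso R f) a.

Lemma bf_iso_ext (G H : gc_obj D) (f g : group_iso G H) (a : A G) :
  f =1 g -> bf_iso f a = bf_iso g a.
Proof. by move=> fg; rewrite /bf_iso (RBiso_ext R fg). Qed.

(** Together with [bf_iso_ext], this reduces equalities between chains of transports to pointwise
    identities of group maps. *)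
Lemma bf_iso_comp (G H K : gc_obj D) (f : group_iso H K) (g : group_iso G H)
    (a : A G) : bf_iso f (bf_iso g a) = bf_iso (giso_comp f g) a.
Proof. by rewrite /bf_iso -bf_map_comp RBiso_comp. Qed.

Lemma bf_iso_id (G : gc_obj D) (f : group_iso G G) (a : A G) :
  f =1 id -> bf_iso f a = a.
Proof.
by move=> fid; rewrite (bf_iso_ext (g := giso_id G)) //; apply: bf_map_id.
Qed.

Lemma bf_isoK (G H : gc_obj D) (f : group_iso G H) :
  cancel (@bf_iso G H f) (bf_iso (giso_inv f)).
Proof. by move=> a; rewrite bf_iso_comp bf_iso_id //; apply: giso_funK. Qed.

Lemma bf_iso_inj (G H : gc_obj D) (f : group_iso G H) :
  injective (@bf_iso G H f).
Proof. exact: can_inj (bf_isoK f). Qed.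

End BisetFunctorIso.

(** * Closure properties of the commutant *)

Section Commutant.
Variables (R : comPzRingType) (D : group_class) (A : green_functor R D).

Definition bf_swap (G H : gc_obj D) :
    A (obj_prod H G) -> A (obj_prod G H) :=
  bf_iso (G := obj_prod H G) (H := obj_prod G H) (giso_swap G H).

Lemma commutantP (G : gc_obj D) (a : A G) :
  a \in commutant A G <->
  forall (H : gc_obj D) (b : A H), gmul a b = bf_swap (gmul b a).
Proof. by split=> [/asboolP | ?]; last apply/asboolP. Qed.

Lemma gmul_iso (G G' H H' : gc_obj D) (f : group_iso G G')
    (g : group_iso H H') (a : A G) (b : A H) :
  gmul (bf_iso f a) (bf_iso g b)
  = bf_iso (G := obj_prod G H) (H := obj_prod G' H') (giso_prod f g)
      (gmul a b).
Proof. by rewrite /bf_iso -gmul_map RBiso_prod. Qed.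

Lemma gmul_isol (G G' H : gc_obj D) (f : group_iso G G') (a : A G) (b : A H) :
  gmul (bf_iso f a) b
  = bf_iso (G := obj_prod G H) (H := obj_prod G' H) (giso_prod f (giso_id H))
      (gmul a b).
Proof. by rewrite -gmul_iso [in RHS](bf_iso_id (f := giso_id H)). Qed.

Lemma gmul_isor (G H H' : gc_obj D) (g : group_iso H H') (a : A G) (b : A H) :
  gmul a (bf_iso g b)
  = bf_iso (G := obj_prod G H) (H := obj_prod G H') (giso_prod (giso_id G) g)
      (gmul a b).
Proof. by rewrite -gmul_iso [in RHS](bf_iso_id (f := giso_id G)). Qed.

Lemma bf_swap_map (G G' H H' : gc_obj D) (phi : RB R G' G) (psi : RB R H' H)
    (x : A (obj_prod H G)) :
  bf_swap (bf_map A (G := obj_prod H G) (H := obj_prod H' G')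
    (RBprod psi phi) x)
  = bf_map A (G := obj_prod G H) (H := obj_prod G' H')
      (RBprod phi psi) (bf_swap x).
Proof. by rewrite /bf_swap /bf_iso -!bf_map_comp RBiso_swapC. Qed.

Lemma commutant_submod (G : gc_obj D) : GRing.submod_closed (commutant A G).
Proof.
(* Scalar -1 and two zero vectors give [f 0 = - f 0 + f 0]. *)
have lin0 (U V : lmodType R) (f : U -> V) : linear f -> f 0 = 0.
  by move=> fl; have := fl (-1) 0 0; rewrite scaler0 addr0 scaleN1r addNr.
split=> [|r a a' /commutantP aP /commutantP a'P]; apply/commutantP => H b.
  rewrite (lin0 _ _ _ (gmul_linearl b)) (lin0 _ _ _ (gmul_linearr b)).
  by rewrite /bf_swap /bf_iso linear0.
by rewrite gmul_linearl gmul_linearr aP a'P /bf_swap /bf_iso linearP.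
Qed.

Lemma commutant_map (G G' : gc_obj D) (phi : RB R G' G) (a : A G) :
  a \in commutant A G -> bf_map A phi a \in commutant A G'.
Proof.
move=> /commutantP aP; apply/commutantP => H b.
(* Writing [b] as its image under the identity lets [phi] act on the whole product as [phi] times
   the identity. *)
rewrite -[b in LHS]bf_map_id -[b in RHS]bf_map_id -!gmul_map aP.
by rewrite bf_swap_map.
Qed.

Lemma commutant_mul (G H : gc_obj D) (a : A G) (b : A H) :
  a \in commutant A G -> b \in commutant A H ->
  gmul a b \in commutant A (obj_prod G H).
Proof.
move=> /commutantP aP /commutantP bP; apply/commutantP => K c.
have acb : gmul a (gmul c b)
    = bf_iso (G := obj_prod (obj_prod G K) H) (H := obj_prod G (obj_prod K H))
        (giso_inv (giso_assoc G K H)) (gmul (gmul a c) b).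
  by rewrite -gmulA bf_isoK.
(* The factors move as [(ab)c], [a(bc)], [a(cb)], [(ac)b], [(ca)b], [c(ab)]; both sides become
   transports of [c(ab)]. *)
rewrite -gmulA bP gmul_isor acb aP gmul_isol -gmulA.
rewrite -![bf_map _ (RBiso _ _) _]/(bf_iso _ _) !bf_iso_comp.
apply: bf_iso_ext => -[k [g h]] /=.
(* The inverse associator is a chosen preimage and does not compute; cancellation gives its
   value. *)
have -> : giso_inv_fun (giso_assoc G K H) (g, k, h) = (g, (k, h)) => //.
exact: (giso_funK (giso_assoc G K H) (g, (k, h))).
Qed.

Lemma commutant_one : gone A \in commutant A (obj_unit D).
Proof.
apply/commutantP => H b.
apply: (@bf_iso_inj _ _ A (obj_prod (obj_unit D) H) H (giso_unitl H)).
(* The left side is now [b], rewritten through the right unit law; what remains is that the switch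
   followed by the left unit map is the right unit map. *)
rewrite bf_iso_comp [LHS]gmul1l -[LHS]gmul1r.
exact: bf_iso_ext.
Qed.

End Commutant.

Theorem lemma19 (R : comPzRingType) (D : group_class) (A : green_functor R D) :
  green_subfunctor (commutant A).
Proof.
split; first split.
- exact: commutant_submod.
- exact: commutant_map.
- exact: commutant_mul.
- exact: commutant_one.
Qed.
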